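(* Memoryless Markov embeddings preserve reversibility: let $L_\star\colon\mathcal{W}(\mathcal{X},\mathcal{D})\to\mathcal{W}(\mathcal{Y},\mathcal{E})$ be a memoryless Markov embedding. Then $$\bar P\in\mathcal{W}_{\mathsf{rev}}(\mathcal{X},\mathcal{D})\implies L_\star\bar P\in\mathcal{W}_{\mathsf{rev}}(\mathcal{Y},\mathcal{E}).$$
   Context: All vertex sets are finite with at least two elements; $(\mathcal{X},\mathcal{D})$, $(\mathcal{Y},\mathcal{E})$ are strongly connected digraphs. $\mathcal{W}(\mathcal{Y},\mathcal{E})$ is the set of row-stochastic matrices on $\mathcal{Y}$ strictly positive on $\mathcal{E}$ and zero outside. $\mathcal{W}_{\mathsf{rev}}(\mathcal{Y},\mathcal{E})$ is the subset of reversible matrices: $\pi(y)P(y,y')=\pi(y')P(y',y)$ for all $y,y'$, with $\pi$ the stationary distribution of $P$ (similarly for $(\mathcal{X},\mathcal{D})$). Memoryless Markov embedding $L_\star\colon\mathcal{W}(\mathcal{X},\mathcal{D})\to\mathcal{W}(\mathcal{Y},\mathcal{E})$: there are a surjective map $\kappa\colon\mathcal{Y}\to\mathcal{X}$ with $\{(\kappa(y),\kappa(y')):(y,y')\in\mathcal{E}\}=\mathcal{D}$ and a function $L\colon\mathcal{Y}\to\mathbb{R}$ such that the matrix $\Lambda(y,y')=L(y')$ if $(\kappa(y),\kappa(y'))\in\mathcal{D}$ and $0$ otherwise, is strictly positive on $\mathcal{E}$ and zero outside $\mathcal{E}$, and $(\Lambda(y,y'))_{y'\in\kappa^{-1}(x')}$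 is a probability distribution on $\kappa^{-1}(x')$ whenever $(\kappa(y),x')\in\mathcal{D}$; the embedding is $L_\star\bar P(y,y')=\bar P(\kappa(y),\kappa(y'))L(y')$. *)

(* Defs.v *)
From mathcomp Require Import all_boot all_order all_algebra.
From mathcomp Require Import reals.

Set Implicit Arguments.
Unset Strict Implicit.
Unset Printing Implicit Defensive.

Import Order.TTheory GRing.Theory Num.Theory.

Local Open Scope ring_scope.

(* A digraph on X is its set of directed edges; loops are allowed.  Matrices
   indexed by a finite type X are functions X -> X -> R. *)

Definition strongly_connected (X : finType) (D : {set X * X}) : Prop :=
  forall x x' : X, connect [rel a b | (a, b) \in D] x x'.

Definition supported_on (R : realType) (X : finType) (D : {set X * X})
    (P : X -> X -> R) : Prop :=
  (forall x x' : X, (x, x') \in D -> 0 < P x x') /\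
  (forall x x' : X, (x, x') \notin D -> P x x' = 0).

(* Nonnegativity of the entries follows from the support condition. *)
Definition W (R : realType) (X : finType) (D : {set X * X})
    (P : X -> X -> R) : Prop :=
  supported_on D P /\ (forall x : X, \sum_x' P x x' = 1).

Definition stationary_distribution (R : realType) (X : finType)
    (P : X -> X -> R) (pi : X -> R) : Prop :=
  [/\ forall x : X, 0 <= pi x,
      \sum_x pi x = 1
    & forall x' : X, \sum_x pi x * P x x' = pi x'].

(* When D is strongly connected, every P in W D is irreducible, so the
   stationary distribution pi is unique. *)
Definition Wrev (R : realType) (X : finType) (D : {set X * X})
    (P : X -> X -> R) : Prop :=
  W D P /\
  exists pi : X -> R, stationary_distribution P pi /\
    forall x x' : X, pi x * P x x' = pi x' * P x' x.

Definition Lambda (R : realType) (X Y : finType) (D : {set X * X})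
    (kappa : Y -> X) (L : Y -> R) (y y' : Y) : R :=
  if (kappa y, kappa y') \in D then L y' else 0.

Definition memoryless_data (R : realType) (X Y : finType)
    (D : {set X * X}) (E : {set Y * Y}) (kappa : Y -> X) (L : Y -> R) : Prop :=
  [/\ forall x : X, exists y : Y, kappa y = x,
      [set (kappa e.1, kappa e.2) | e in E] = D,
      supported_on E (Lambda D kappa L)
    & forall (y : Y) (x' : X), (kappa y, x') \in D ->
        (forall y' : Y, kappa y' = x' -> 0 <= Lambda D kappa L y y') /\
        \sum_(y' | kappa y' == x') Lambda D kappa L y y' = 1].

(* Lstar is constrained only on W D.  That it maps W D into W E is a
   consequence of the conditions on kappa and L, not an assumption. *)
Definition memoryless_embedding (R : realType) (X Y : finType)
    (D : {set X * X}) (E : {set Y * Y})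
    (Lstar : (X -> X -> R) -> (Y -> Y -> R)) : Prop :=
  exists (kappa : Y -> X) (L : Y -> R),
    memoryless_data D E kappa L /\
    forall P : X -> X -> R, W D P ->
      forall y y' : Y, Lstar P y y' = P (kappa y) (kappa y') * L y'.

(* Main.v *)
(* With [rho] the reversing distribution of [Pbar], the measure
   [rho (kappa y) * L y] reverses [Lstar Pbar]: both sides of detailed balance
   carry the same factor [L y * L y'].  It is a probability because [L] sums to
   1 over each fibre of [kappa], every vertex of [D] being the head of an
   edge. *)
Require Import Defs.
From mathcomp Require Import all_boot all_order all_algebra.
From mathcomp Require Import reals.

Import Order.TTheory GRing.Theory Num.Theory.

Local Open Scope ring_scope.

(** Some vertex [z] differs from [x'], so a path from [z] to [x'] is nonempty and its last edge
    enters [x']. *)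
Lemma strongly_connected_in_edge (X : finType) (D : {set X * X}) (x' : X) :
  (2 <= #|X|)%N -> strongly_connected D -> exists x, (x, x') \in D.
Proof.
move=> hX hD.
have /existsP[z zx'] : [exists z, z != x'].
  apply: contraLR hX => /existsPn all_x'; rewrite -ltnNge ltnS.
  by apply/card_le1P => x _ z; rewrite !inE (eqP (negPn (all_x' x)))
    (eqP (negPn (all_x' z))) eqxx.
have /connectP[p] := hD z x'.
case/lastP: p => [_ x'z | p w]; first by rewrite x'z eqxx in zx'.
rewrite rcons_path last_rcons => /andP[_ edge] x'w.
by exists (last z p); rewrite x'w.
Qed.

(** Serves twice: with [f] a row of [Pbar] it gives the row sums of [Lstar Pbar], and with
    [f := rho] the total mass of the lifted measure. *)
Lemma sum_fibres (R : realType) (X Y : finType) (kappa : Y -> X) (L : Y -> R)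
    (f : X -> R) :
  (forall x, \sum_(y | kappa y == x) L y = 1) ->
  \sum_y f (kappa y) * L y = \sum_x f x.
Proof.
move=> L1; rewrite (partition_big kappa predT) //=; apply: eq_bigr => x _.
by rewrite -[RHS]mulr1 -(L1 x) mulr_sumr; apply: eq_bigr => y /eqP ->.
Qed.

(** Surjectivity lifts the tail of an edge into [x'] to some [y], and row [y] of [Lambda] agrees
    with [L] on the fibre of [x']. *)
Lemma memoryless_fibre (R : realType) (X Y : finType)
    (D : {set X * X}) (E : {set Y * Y}) (kappa : Y -> X) (L : Y -> R) (x' : X) :
  (exists x, (x, x') \in D) -> memoryless_data D E kappa L ->
  (forall y', kappa y' = x' -> 0 <= L y') /\ \sum_(y' | kappa y' == x') L y' = 1.
Proof.
move=> [x Dxx'] [surj _ _ distr]; have [y yx] := surj x.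
rewrite -yx in Dxx'; have [L0 L1] := distr y x' Dxx'.
have LambdaE y' : kappa y' = x' -> Lambda D kappa L y y' = L y'.
  by move=> y'x'; rewrite /Lambda y'x' Dxx'.
split=> [y' y'x' | ]; first by rewrite -LambdaE // L0.
by rewrite -L1; apply: eq_bigr => y' /eqP /LambdaE.
Qed.

(** On [E], positivity of [Lambda] forces both an edge of [D] below and [0 < L y']. Off [E], either
    there is no edge below and [P] vanishes, or [L y'] is 0. *)
Lemma memoryless_supported_on (R : realType) (X Y : finType)
    (D : {set X * X}) (E : {set Y * Y}) (kappa : Y -> X) (L : Y -> R)
    (P : X -> X -> R) :
  memoryless_data D E kappa L -> supported_on D P ->
  supported_on E (fun y y' => P (kappa y) (kappa y') * L y').
Proof.
move=> [_ _ [LambdaE LambdaNE] _] [PD PND]; split=> y y'.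
  move/LambdaE; rewrite /Lambda; case: ifP => [Dyy' Ly' | _]; last by rewrite ltxx.
  by rewrite mulr_gt0 // PD.
move/LambdaNE; rewrite /Lambda; case: ifP => [_ -> | /negbT Dyy' _].
  by rewrite mulr0.
by rewrite PND // mul0r.
Qed.

Theorem lemma4p7 (R : realType) (X Y : finType)
    (D : {set X * X}) (E : {set Y * Y})
    (hX : (2 <= #|X|)%N) (hY : (2 <= #|Y|)%N)
    (hD : strongly_connected D) (hE : strongly_connected E)
    (Lstar : (X -> X -> R) -> (Y -> Y -> R))
    (hL : memoryless_embedding D E Lstar)
    (Pbar : X -> X -> R) :
  Wrev D Pbar -> Wrev E (Lstar Pbar).
Proof.
case: hL => kappa [L [data LstarE]] [WP [rho [[rho0 rho1 _] balance]]].
have {}LstarE := LstarE _ WP; have [suppP P1] := WP.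
have fibre x' := memoryless_fibre R X Y D E kappa L x'
  (strongly_connected_in_edge X D x' hX hD) data.
have L1 x' := (fibre x').2.
have row1 y : \sum_y' Lstar Pbar y y' = 1.
  under eq_bigr do rewrite LstarE.
  by rewrite (sum_fibres R X Y kappa L (Pbar (kappa y)) L1).
have balanceY y y' : rho (kappa y) * L y * Lstar Pbar y y'
    = rho (kappa y') * L y' * Lstar Pbar y' y.
  by rewrite !LstarE mulrACA balance [L y * _]mulrC mulrACA.
split; first split=> //.
  have [suppE suppNE] := memoryless_supported_on _ _ _ _ _ _ _ _ data suppP.
  by split=> y y' ?; rewrite LstarE; [apply: suppE | apply: suppNE].
exists (fun y => rho (kappa y) * L y); split=> //; split=> [y | | y'].
- by rewrite mulr_ge0 // (fibre (kappa y)).1.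
- by rewrite (sum_fibres R X Y kappa L rho L1).
(* Detailed balance gives stationarity: it turns the sum over column [y'] into the mass of [y']
   times the sum of row [y'], which is 1. *)
- under eq_bigr do rewrite balanceY.
  by rewrite -mulr_sumr row1 mulr1.
Qed.
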